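(* Let $M$ be an Archimedean quadratic module of $\mathcal O[X]$ and set $$S:=\{x\in\mathbb R^n\mid\forall p\in M:\operatorname{st}(p(x))\ge0\}.$$ Moreover, suppose $k\in\mathbb N_0$ and let $x_1,\dots,x_k\in\mathcal O^n$ satisfy $\operatorname{st}(x_i)\ne\operatorname{st}(x_j)$ for $i,j\in\{1,\dots,k\}$ with $i\ne j$. Then $u:=u_{x_1}\cdots u_{x_k}$ is a unit for $M\cap I$ in $$I:=I_{x_1}^2\cdots I_{x_k}^2=I_{x_1}^2\cap\dots\cap I_{x_k}^2$$ (in particular, product and intersection agree), and for all pure states $\varphi$ of $(I,M\cap I,u)$ (where $I$ is understood as a real vector space), exactly one of the following cases occurs: (1) There is an $x\in S\setminus\{\operatorname{st}(x_1),\dots,\operatorname{st}(x_k)\}$ such that $$\varphi(p)=\operatorname{st}\left(\frac{p(x)}{u(x)}\right)\quad\text{for all }p\in I.$$ (2) There are $i\in\{1,\dots,k\}$ and $v_1,\dots,v_n\in\mathbb R^n$ such that $\sum_{\ell=1}^nv_\ell^Tv_\ell=1$ and $$\varphi(p)=\operatorname{st}\left(\frac{\sum_{\ell=1}^nv_\ell^T(\operatorname{Hess}p)(x_i)v_\ell}{2\prod_{j=1,\,j\ne i}^ku_{x_j}(x_i)}\right)\quad\text{for all }p\in I.$$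
   Context: $R$ is a real closed field containing $\mathbb R$ as a subfield, $n\in\mathbb N_0$. $\mathcal O=\{a\in R\mid\exists N\in\mathbb N:-N\le a\le N\}$ is its subring of finite elements, $\mathfrak m=\{a\in R\mid\forall N\in\mathbb N:-\frac1N\le a\le\frac1N\}$ its ideal of infinitesimals, and for $a\in\mathcal O$ the standard part $\operatorname{st}(a)$ is the unique real number with $a-\operatorname{st}(a)\in\mathfrak m$; for $x\in\mathcal O^n$, $\operatorname{st}(x)$ is taken componentwise. $\mathcal O[X]=\mathcal O[X_1,\dots,X_n]$. A quadratic module of a ring $A$ is a set $M\subseteq A$ with $0,1\in M$, $M+M\subseteq M$ and $a^2M\subseteq M$ for all $a\in A$; it is Archimedean if for every $a\in A$ there is $N\in\mathbb N$ with $N\pm a\in M$. For $x\in\mathcal O^n$, $I_x:=\{p\in\mathcal O[X]\mid p(x)=0\}$ (an ideal), $I_x^2$ is its square as an ideal, and $u_x:=(X_1-x_1)^2+\dots+(X_n-x_n)^2$ (coordinates of $x$). Empty products of polynomials are $1$; empty products/intersections of ideals are $\mathcal O[X]$. $\operatorname{Hess}p$ is the (formal) Hessian matrix. For a real vector space $V$, a convex cone $C\subseteq V$ (i.e. $0\in C$, $C+C\subseteq C$, $\mathbb R_{\ge0}C\subseteq C$) and $u\in V$: $u$ is a unit for $C$ in $V$ if for every $x\in V$ there is $N\in\mathbb N$ with $Nu+x\in C$; a state of $(V,C,u)$ is an $\mathbb R$-linear $\varphi\colon V\to\mathbb R$ with $\varphi(C)\subseteq\mathbb R_{\ge0}$ and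 $\varphi(u)=1$; a pure state is an extreme point of the convex set of all states (in $\mathbb R^V$). *)

(* Defs.v *)
From HB Require Import structures.
From mathcomp Require Import all_boot all_order all_algebra.
From mathcomp Require Import boolp classical_sets functions reals.
From mathcomp Require Import mpoly.

Set Implicit Arguments.
Unset Strict Implicit.
Unset Printing Implicit Defensive.

Import Order.TTheory GRing.Theory Num.Theory.

Local Open Scope classical_set_scope.
Local Open Scope ring_scope.

Section FiniteElements.
Context (R : rcfType).

Definition is_finite : {pred R} :=
  fun a => `[< exists2 N : nat, (0 < N)%N & - N%:R <= a <= N%:R >].

Definition infinitesimal (a : R) : Prop :=
  forall N : nat, (0 < N)%N -> - N%:R^-1 <= a <= N%:R^-1.

Lemma is_finiteP (a : R) :
  reflect (exists2 N : nat, (0 < N)%N & `|a| <= N%:R) (a \in is_finite).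
Proof.
by apply: (iffP (asboolP _)) => -[N N0 aN]; exists N => //;
  rewrite ler_norml in aN *.
Qed.

Fact is_finite_subring : subring_closed is_finite.
Proof.
split.
- by apply/is_finiteP; exists 1%N => //; rewrite normr1.
- move=> a b /is_finiteP[N N0 aN] /is_finiteP[N' N'0 bN'].
  apply/is_finiteP; exists (N + N')%N; first by rewrite addn_gt0 N0.
  by rewrite natrD (le_trans (ler_normB _ _))// lerD.
- move=> a b /is_finiteP[N N0 aN] /is_finiteP[N' N'0 bN'].
  apply/is_finiteP; exists (N * N')%N; first by rewrite muln_gt0 N0.
  by rewrite natrM normrM ler_pM.
Qed.

HB.instance Definition _ :=
  GRing.isSubringClosed.Build R is_finite is_finite_subring.

Record fin := Fin { finval :> R; finvalP : finval \in is_finite }.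

HB.instance Definition _ := [isSub for finval].
HB.instance Definition _ := [Choice of fin by <:].
HB.instance Definition _ := [SubChoice_isSubComNzRing of fin by <:].

End FiniteElements.

(* The subfield of real numbers is given by a ring morphism [iota] from a model
   [K] of the reals; such a morphism is injective and, nonnegative reals being
   squares, it preserves the order. *)
Section StandardPart.
Context (K : realType) (R : rcfType) (iota : {rmorphism K -> R}).

Lemma iota_le (r s : K) : (iota r <= iota s) = (r <= s).
Proof.
have mono (x y : K) : x <= y -> iota x <= iota y.
  move=> xy; rewrite -subr_ge0 -rmorphB -[y - x]sqr_sqrtr ?subr_ge0//.
  by rewrite rmorphXn sqr_ge0.
apply/idP/idP => [|/mono//]; apply: contraTT; rewrite -!ltNge => sr.
by rewrite lt_neqAle mono ?ltW// andbT fmorph_eq lt_eqF.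
Qed.

Fact iota_finite (r : K) : iota r \in @is_finite R.
Proof.
apply/is_finiteP; exists (Num.bound `|r|) => //.
have /ltW := archi_boundP (normr_ge0 r); rewrite !ler_norml => /andP[h1 h2].
by rewrite -(rmorph_nat iota) -rmorphN !iota_le h1.
Qed.

Definition fin_real (r : K) : fin R := Fin (iota_finite r).

Fact fin_real_zmod : zmod_morphism fin_real.
Proof. by move=> r s; apply: val_inj; rewrite /= rmorphB. Qed.

Fact fin_real_monoid : monoid_morphism fin_real.
Proof.
by split=> [|r s]; apply: val_inj; rewrite /= ?rmorph1 ?rmorphM.
Qed.

HB.instance Definition _ :=
  GRing.isZmodMorphism.Build K (fin R) fin_real fin_real_zmod.
HB.instance Definition _ :=
  GRing.isMonoidMorphism.Build K (fin R) fin_real fin_real_monoid.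

(* Defined on all of [R]; the value is 0 on the elements that are not finite. *)
Definition st (a : R) : K := xget 0 [set r : K | infinitesimal (a - iota r)].

Lemma infinitesimal_std_uniq (a : R) (r s : K) :
  infinitesimal (a - iota r) -> infinitesimal (a - iota s) -> r = s.
Proof.
move=> ar as'; apply/eqP; rewrite -subr_eq0 -normr_le0 leNgt; apply/negP => d0.
have [N N0 Nd] : exists2 N : nat, (0 < N)%N & 2 / `|r - s| < N%:R.
  exists (Num.bound (2 / `|r - s|)) => //.
  by rewrite archi_boundP// divr_ge0// ltW.
have N0' : 0 < N%:R :> K by rewrite ltr0n.
have : iota `|r - s| <= iota (2 / N%:R).
  have -> : iota `|r - s| = `|iota (r - s)|.
    case: (ger0P (r - s)) => rs.
      by rewrite ger0_norm// -(rmorph0 iota) iota_le.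
    by rewrite rmorphN ltr0_norm// lt_neqAle fmorph_eq0 lt_eqF//=
      -[leRHS](rmorph0 iota) iota_le ltW.
  have -> : iota (r - s) = (a - iota s) - (a - iota r).
    by rewrite rmorphB opprB [_ + (_ - a)]addrC addrA subrK.
  rewrite (le_trans (ler_normB _ _))// mulr2n mulrDl mul1r rmorphD/=.
  by rewrite fmorphV rmorph_nat lerD// ler_norml; [exact: as'|exact: ar].
by rewrite iota_le leNgt ltr_pdivrMr// mulrC -ltr_pdivrMr// Nd.
Qed.

Lemma st_infinitesimal (a : R) :
  a \in @is_finite R -> infinitesimal (a - iota (st a)).
Proof.
move=> /is_finiteP[B B0]; rewrite ler_norml => /andP[Ba aB].
suff [r ar] : exists r : K, infinitesimal (a - iota r).
  by rewrite /st; case: xgetP => [s _ //|/(_ r)/(_ ar)].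
pose E := [set r : K | iota r <= a].
have ubE : ubound E B%:R.
  by move=> r Er; rewrite -iota_le rmorph_nat (le_trans Er).
have supE : has_sup E.
  by split; [exists (- B%:R); rewrite /E/= rmorphN rmorph_nat|exists B%:R].
exists (sup E) => N N0.
have N0' : 0 < N%:R^-1 :> K by rewrite invr_gt0 ltr0n.
have NE : N%:R^-1 = iota N%:R^-1 by rewrite fmorphV rmorph_nat.
rewrite NE lerBrDr lerBlDr -rmorphN -!rmorphD; apply/andP; split.
  have [r Er] := sup_adherent N0' supE.
  by rewrite addrC => /ltW; rewrite -iota_le => /le_trans; apply.
rewrite leNgt; apply/negP => /ltW/(ub_le_sup (proj2 supE)).
by rewrite -subr_ge0 opprD addrCA subrr addr0 oppr_ge0 leNgt N0'.
Qed.

Definition st_pt n (x : 'I_n -> fin R) : 'I_n -> K := fun l => st (x l).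

Definition fin_pt n (x : 'I_n -> K) : 'I_n -> fin R := fun l => fin_real (x l).

End StandardPart.

Section Ideals.
Context (A : comNzRingType).

Definition ideal_closed (I : set A) : Prop :=
  [/\ I 0, forall a b, I a -> I b -> I (a + b) & forall a b, I b -> I (a * b)].

Record ideal := Ideal { ideal_set :> set A; idealP : ideal_closed ideal_set }.

Fact idealT_closed : ideal_closed setT. Proof. by []. Qed.
Definition idealT : ideal := Ideal idealT_closed.

Fact ideal_gen_closed (G : set A) : ideal_closed (smallest ideal_closed G).
Proof.
split=> [J [[J0 _ _] _]//|a b Ia Ib J [Jid GJ]|a b Ib J [Jid GJ]].
  by case: (Jid) => _ JD _; apply: JD; [exact: Ia|exact: Ib].
by case: (Jid) => _ _ JM; apply: JM; exact: Ib.
Qed.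
Definition ideal_gen (G : set A) : ideal := Ideal (ideal_gen_closed G).

Definition ideal_mul (I J : ideal) : ideal :=
  ideal_gen [set a * b | a in (I : set A) & b in (J : set A)].

Definition quadratic_module (M : set A) : Prop :=
  [/\ M 0, M 1, forall a b, M a -> M b -> M (a + b)
    & forall a b, M b -> M (a ^+ 2 * b)].

Definition archimedean_qm (M : set A) : Prop :=
  forall a, exists2 N : nat, (0 < N)%N & M (N%:R + a) /\ M (N%:R - a).

End Ideals.

Section States.
Context (K : realType) (V : lmodType K).

Definition unit_for (C : set V) (u : V) : Prop :=
  forall x, exists2 N : nat, (0 < N)%N & C (u *+ N + x).

Definition states (C : set V) (u : V) : set (V -> K^o) :=
  [set phi | [/\ scalar phi, forall c, C c -> 0 <= phi c & phi u = 1]].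

Definition extreme_point (E : lmodType K) (S : set E) : set E :=
  [set x | S x /\ forall y z (t : K), S y -> S z -> 0 < t < 1 ->
                    x = t *: y + (1 - t) *: z -> y = x /\ z = x].

Definition pure_states (C : set V) (u : V) : set (V -> K^o) :=
  extreme_point (states C u).

End States.

Section Polynomials.
Context (R : rcfType) (n : nat).
Implicit Types (x : 'I_n -> fin R) (p : {mpoly (fin R)[n]}).

Fact vanishing_closed x : ideal_closed [set p | p.@[x] = 0].
Proof.
split=> [|p q /= p0 q0|p q /= q0]; first by rewrite /= meval0.
  by rewrite mevalD p0 q0 addr0.
by rewrite mevalM q0 mulr0.
Qed.
Definition vanishing_ideal x : ideal {mpoly (fin R)[n]} :=
  Ideal (vanishing_closed x).

Definition sqdist_poly x : {mpoly (fin R)[n]} :=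
  \sum_(l < n) ('X_l - (x l)%:MP) ^+ 2.

Definition hessian p : 'M[{mpoly (fin R)[n]}]_n :=
  \matrix_(i, j) mderiv i (mderiv j p).

Definition hessian_at p x : 'M[R]_n :=
  map_mx (fun q => finval q.@[x]) (hessian p).

End Polynomials.

(* An ideal of the polynomial ring, regarded as a real vector space. *)
Section RealSpace.
Context (R : rcfType) (n : nat) (I : ideal {mpoly (fin R)[n]}).

Definition mem_ideal : {pred {mpoly (fin R)[n]}} :=
  fun p => `[< (I : set _) p >].

Fact mem_ideal_zmod : zmod_closed mem_ideal.
Proof.
case: (idealP I) => I0 ID IM; split; first exact/asboolP.
move=> p q /asboolP Ip /asboolP Iq; apply/asboolP; apply: ID => //.
by rewrite -mulN1r; apply: IM.
Qed.

HB.instance Definition _ :=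
  GRing.isZmodClosed.Build {mpoly (fin R)[n]} mem_ideal mem_ideal_zmod.

Record ideal_space (K : realType) (iota : {rmorphism K -> R}) := IdealSpace
  { poly_of :> {mpoly (fin R)[n]}; poly_ofP : poly_of \in mem_ideal }.

Context (K : realType) (iota : {rmorphism K -> R}).
Local Notation V := (ideal_space iota).

HB.instance Definition _ := [isSub for @poly_of K iota].
HB.instance Definition _ := [Choice of V by <:].
HB.instance Definition _ := [SubChoice_isSubZmodule of V by <:].

Fact real_scale_subproof (r : K) (p : V) :
  (fin_real iota r)%:MP * (p : {mpoly (fin R)[n]}) \in mem_ideal.
Proof.
by case: (idealP I) => _ _ IM; apply/asboolP/IM/asboolP/(poly_ofP p).
Qed.

Definition real_scale (r : K) (p : V) : V :=
  IdealSpace iota (real_scale_subproof r p).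

Fact real_scaleA a b p : real_scale a (real_scale b p) = real_scale (a * b) p.
Proof. by apply: val_inj; rewrite /= rmorphM mpolyCM mulrA. Qed.

Fact real_scale1 : left_id 1 real_scale.
Proof. by move=> p; apply: val_inj; rewrite /= rmorph1 mul1r. Qed.

Fact real_scaleDr : right_distributive real_scale +%R.
Proof. by move=> r p q; apply: val_inj; rewrite /= mulrDr. Qed.

Fact real_scaleDl p : {morph real_scale^~ p : a b / a + b}.
Proof. by move=> a b; apply: val_inj; rewrite /= rmorphD mpolyCD mulrDl. Qed.

HB.instance Definition _ := GRing.Zmodule_isLmodule.Build K V
  real_scaleA real_scale1 real_scaleDr real_scaleDl.

End RealSpace.

(* Main.v *)
Require Import Defs.
From HB Require Import structures.
From mathcomp Require Import all_boot all_order all_algebra.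
From mathcomp Require Import boolp classical_sets functions reals.
From mathcomp Require Import mpoly.
From mathcomp Require Import ring lra.

Set Implicit Arguments.
Unset Strict Implicit.
Unset Printing Implicit Defensive.

Import Order.TTheory GRing.Theory Num.Theory.

Local Open Scope classical_set_scope.
Local Open Scope ring_scope.

(** Write u for the product of the u_(x_i), I for the product of the ideals
    I_(x_i)^2 and V for I as a real vector space.

    _The ideal I._ Points with different standard parts have comaximal vanishing
    ideals, because some coordinate of their difference is a unit of O. Squares
    of comaximal ideals are comaximal, so product and intersection agree
    ([bigmul_comaximalE]).

    _u is a unit._ Every element of I is a combination of products a b where
    u - a^2 and u - b^2 are sums of squares ([bigmul_dominated]). The identity
    4 q a b = q (a + b)^2 - q (a - b)^2 and an Archimedean bound for q then bound
    q a b by a multiple of u modulo M ([dominated_bounded]).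

    _Pure states are multiplicative._ A pure state phi satisfies
    phi (a v) = phi (a u) phi v for all polynomials a and all v in I
    ([pure_state_mul]). If 1 - a^2 lies in M, then 3 phi is the sum of the two
    functionals phi ((1 + a^2) -) and phi ((2 - a^2) -), and extremality applies
    as soon as the second is nonnegative on the cone; this is the inequality
    phi (a^2 v) <= phi v ([state_sqr_le]), obtained by iterating Cauchy-Schwarz.
    Scaling and polarisation give all a.

    _The point._ Hence a |-> phi (a u) is a ring morphism from O[X] to the reals.
    It is the standard part on O, since nonnegative elements of O are squares, so
    it is p |-> st (p (x)) for a real point x ([character_point]), and x lies in S
    because u M is contained in M.

    _The two cases._ Multiplicativity with a = u gives
    st (u (x)) phi p = st (p (x)). If x differs from all st (x_i), then
    st (u (x)) is nonzero and phi is evaluation at x divided by u (x)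
    ([phi_evaluation]). If x = st (x_i), let w be the product of the other
    factors of u. Then psi p = phi (w p) is defined on I_(x_i)^2, is
    multiplied by st (q (x_i)) when p is multiplied by q, and therefore depends
    only on the Hessian of p at x_i ([quadratic_functional]). The coefficients
    psi ((X_l - x_il) (X_m - x_im)) form a positive semidefinite matrix of trace
    psi (u_(x_i)) = phi u = 1, and writing it as a sum of n matrices v v^T
    ([psd_sum_rank_one]) yields the second formula ([phi_second_order]).

    Either formula determines the morphism a |-> phi (a u), as evaluation at a
    point other than the st (x_i) or at some st (x_i); so they exclude each
    other. *)

(** * Products of comaximal ideals *)
Reserved Notation "a \isin I" (at level 70, I at level 69).
Notation "a \isin I" := (ideal_set I a) : classical_set_scope.

Section IdealProducts.
Context (A : comNzRingType).
Implicit Types (I J : ideal A) (G : set A).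

Lemma idealD I a b : a \isin I -> b \isin I -> a + b \isin I.
Proof. by case: (idealP I) => _ h _; exact: h. Qed.

Lemma idealMl I a b : b \isin I -> a * b \isin I.
Proof. by case: (idealP I) => _ _ h; exact: h. Qed.

Lemma idealMr I a b : a \isin I -> a * b \isin I.
Proof. by rewrite mulrC; exact: idealMl. Qed.

Lemma ideal_gen_incl G : G `<=` ideal_gen G.
Proof. exact: sub_gen_smallest. Qed.

Lemma ideal_gen_min G I : G `<=` I -> ideal_gen G `<=` I.
Proof. by move=> GI; apply: smallest_sub => //; exact: idealP. Qed.

Lemma ideal_mul_mem I J a b : a \isin I -> b \isin J -> a * b \isin ideal_mul I J.
Proof. by move=> Ia Jb; apply: ideal_gen_incl; exists a => //; exists b. Qed.

Fact quotient_closed I a : ideal_closed [set b | a * b \isin I].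
Proof.
split=> [|b c /= Ib Ic|b c /= Ic].
- by rewrite /= mulr0; case: (idealP I).
- by rewrite mulrDr; exact: idealD.
- by rewrite mulrCA; exact: idealMl.
Qed.

(** The colon ideal I : a, which turns inclusions between products of ideals
    into statements about one factor at a time. *)
Definition ideal_quotient I a : ideal A := Ideal (quotient_closed I a).

Lemma ideal_gen_mul_min G G' I :
  (forall a b, G a -> G' b -> a * b \isin I) ->
  forall a b, a \isin ideal_gen G -> b \isin ideal_gen G' -> a * b \isin I.
Proof.
move=> GI a b Ga Gb.
have: a \isin ideal_quotient I b.
  apply: (ideal_gen_min _ Ga) => c Gc /=; rewrite mulrC.
  by apply: (ideal_gen_min (I := ideal_quotient I c) _ Gb) => d /= /(GI _ _ Gc).
by rewrite /= mulrC.
Qed.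

Lemma ideal_mul_gen_min G G' I :
  (forall a b, G a -> G' b -> a * b \isin I) ->
  ideal_mul (ideal_gen G) (ideal_gen G') `<=` I.
Proof.
move=> GI; apply: ideal_gen_min => _ [a Ga [b Gb <-]].
exact: ideal_gen_mul_min GI _ _ Ga Gb.
Qed.

Lemma ideal_mulS I I' J J' :
  I `<=` I' -> J `<=` J' -> ideal_mul I J `<=` ideal_mul I' J'.
Proof.
move=> II JJ; apply: ideal_gen_min => _ [a /II Ia [b /JJ Jb <-]].
exact: ideal_mul_mem.
Qed.

Lemma ideal_mul_sub I J : ideal_mul I J `<=` I `&` J.
Proof.
move=> a Ia; split; move: Ia; apply: ideal_gen_min => _ [b Ib [d Jd <-]].
  exact: idealMr.
exact: idealMl.
Qed.

Definition comaximal I J := exists2 a, a \isin I & 1 - a \isin J.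

Lemma comaximal_sym I J : comaximal I J -> comaximal J I.
Proof. by case=> a Ia Ja; exists (1 - a) => //; rewrite subKr. Qed.

Lemma comaximal_mul I J J' :
  comaximal I J -> comaximal I J' -> comaximal I (ideal_mul J J').
Proof.
move=> [a Ia Ja] [b Ib Jb]; exists (a + b - a * b).
  by rewrite -mulrN; apply: idealD; [exact: idealD|exact: idealMr].
have -> : 1 - (a + b - a * b) = (1 - a) * (1 - b) by ring.
exact: ideal_mul_mem.
Qed.

(** If a + b = 1 with a in I and b in J, multiplying such equations out replaces
    each ideal by a product of copies of itself. *)
Lemma comaximal_sq I J :
  comaximal I J -> comaximal (ideal_mul I I) (ideal_mul J J).
Proof.
move=> IJ; have IJJ := comaximal_mul IJ IJ.
apply: comaximal_sym; apply: comaximal_mul; exact: comaximal_sym.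
Qed.

Lemma comaximal_mulE I J :
  comaximal I J -> ideal_mul I J = I `&` J :> set A.
Proof.
move=> [a Ia Ja]; apply/seteqP; split; first exact: ideal_mul_sub.
move=> b [Ib Jb]; have -> : b = a * b + b * (1 - a) by ring.
by apply: idealD; exact: ideal_mul_mem.
Qed.

Lemma comaximal_bigmul (T : eqType) (F : T -> ideal A) (I : ideal A)
    (r : seq T) :
  (forall i, i \in r -> comaximal I (F i)) ->
  comaximal I (\big[@ideal_mul A/idealT A]_(i <- r) F i).
Proof.
elim: r => [|i r IH] h.
  by rewrite big_nil; exists 0 => //; case: (idealP I).
rewrite big_cons; apply: comaximal_mul; first exact/h/mem_head.
by apply: IH => j jr; apply: h; rewrite inE jr orbT.
Qed.

Lemma bigmul_comaximalE (T : eqType) (F : T -> ideal A) (r : seq T) :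
  uniq r -> (forall i j, i != j -> comaximal (F i) (F j)) ->
  (\big[@ideal_mul A/idealT A]_(i <- r) F i : set A)
    = [set p | forall i, i \in r -> p \isin F i].
Proof.
move=> + FF; elim: r => [_|i r IH /= /andP[ir /IH rE]].
  by rewrite big_nil; apply/seteqP; split.
rewrite big_cons comaximal_mulE.
  rewrite rE; apply/seteqP; split=> p /=.
    by move=> [Fi Fr] j; rewrite inE => /orP[/eqP->//|]; exact: Fr.
  move=> Fp; split; first exact/Fp/mem_head.
  by move=> j jr; apply: Fp; rewrite inE jr orbT.
by apply: comaximal_bigmul => j jr; apply: FF; apply: contraNneq ir => ->.
Qed.

End IdealProducts.

(** * Domination by sums of squares *)
Section Domination.
Context (A : comNzRingType).

Definition sum_of_squares (v : A) : Prop :=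
  exists s : seq A, v = \sum_(a <- s) a ^+ 2.

Lemma sosD v w : sum_of_squares v -> sum_of_squares w -> sum_of_squares (v + w).
Proof. by move=> [s ->] [t ->]; exists (s ++ t); rewrite big_cat. Qed.

Lemma sos_sqr a : sum_of_squares (a ^+ 2).
Proof. by exists [:: a]; rewrite big_seq1. Qed.

Lemma sos_sum (T : Type) (r : seq T) (P : pred T) (F : T -> A) :
  (forall i, P i -> sum_of_squares (F i)) ->
  sum_of_squares (\sum_(i <- r | P i) F i).
Proof.
by move=> h; apply: big_ind => //; [exists [::]; rewrite big_nil|exact: sosD].
Qed.

Lemma sosM v w : sum_of_squares v -> sum_of_squares w -> sum_of_squares (v * w).
Proof.
move=> [s ->] [t ->]; rewrite mulr_suml; apply: sos_sum => a _.
rewrite mulr_sumr; apply: sos_sum => b _; rewrite -exprMn; exact: sos_sqr.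
Qed.

Lemma sos1 : sum_of_squares 1.
Proof. by rewrite -(expr1n A 2); exact: sos_sqr. Qed.

Lemma sos_prod (T : Type) (r : seq T) (P : pred T) (F : T -> A) :
  (forall i, P i -> sum_of_squares (F i)) ->
  sum_of_squares (\prod_(i <- r | P i) F i).
Proof.
by move=> h; apply: big_ind => //; [exact: sos1|exact: sosM].
Qed.

Definition dominates v a := sum_of_squares (v - a ^+ 2).

(** The ideal on which v will be an order unit. Its
    generators are products of two dominated elements because the square of a
    vanishing ideal is generated by products of two of the X_l - x_l. *)
Definition dominated_ideal (v : A) : ideal A :=
  ideal_gen [set a * b | a in dominates v & b in dominates v].

(** Because v w - (a b)^2 = (v - a^2) w + a^2 (w - b^2). *)
Lemma dominatesM v w a b : sum_of_squares w ->
  dominates v a -> dominates w b -> dominates (v * w) (a * b).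
Proof.
move=> w0 va wb; rewrite /dominates.
have -> : v * w - (a * b) ^+ 2 = (v - a ^+ 2) * w + a ^+ 2 * (w - b ^+ 2) by ring.
by apply: sosD; apply: sosM => //; exact: sos_sqr.
Qed.

Lemma dominated_idealM v w : sum_of_squares w ->
  ideal_mul (dominated_ideal v) (dominated_ideal w)
    `<=` dominated_ideal (v * w).
Proof.
move=> w0; apply: ideal_mul_gen_min.
move=> _ _ [a va [b vb <-]] [a' wa' [b' wb' <-]].
rewrite mulrACA; apply: ideal_gen_incl.
by exists (a * a'); [exact: dominatesM|exists (b * b') => //; exact: dominatesM].
Qed.

Lemma bigmul_dominated (T : Type) (r : seq T) (F : T -> ideal A) (v : T -> A) :
  (forall i, sum_of_squares (v i)) -> (forall i, F i `<=` dominated_ideal (v i)) ->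
  \big[@ideal_mul A/idealT A]_(i <- r) F i
    `<=` dominated_ideal (\prod_(i <- r) v i).
Proof.
move=> v0 Fv; elim: r => [|i r IH].
  rewrite !big_nil => p _; rewrite -[p]mulr1; apply: idealMl.
  have d1 : dominates 1 1.
    by rewrite /dominates expr1n subrr; exists [::]; rewrite big_nil.
  by apply: ideal_gen_incl; exists 1 => //; exists 1 => //; rewrite mulr1.
rewrite !big_cons.
apply: (subset_trans (ideal_mulS (Fv i) IH)); apply: dominated_idealM.
by apply: sos_prod.
Qed.

Section QuadraticModule.
Context (M : set A) (M_qm : quadratic_module M).

Lemma qmD a b : M a -> M b -> M (a + b).
Proof. by case: M_qm => _ _ h _; exact: h. Qed.

Lemma qmX a b : M b -> M (a ^+ 2 * b).
Proof. by case: M_qm => _ _ _; exact. Qed.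

Lemma qm_nat N : M N%:R.
Proof.
case: M_qm => M0 M1 _ _; elim: N => [//|N IH].
by rewrite -natr1; exact: qmD.
Qed.

Lemma qmMn a N : M a -> M (a *+ N).
Proof.
case: M_qm => M0 M1 _ _ Ma; elim: N => [|N IH]; first by rewrite mulr0n.
by rewrite mulrS; exact: qmD.
Qed.

Lemma qm_sosM v a : sum_of_squares v -> M a -> M (v * a).
Proof.
case: M_qm => M0 _ _ _ [s ->] Ma; rewrite mulr_suml.
by apply: big_ind => //; [exact: qmD|move=> b _; exact: qmX].
Qed.

Lemma qm_sos v : sum_of_squares v -> M v.
Proof. by case: M_qm => _ M1 _ _ v0; rewrite -[v]mulr1; exact: qm_sosM. Qed.

Context (M_arch : archimedean_qm M).
(* The square of one half lets an element of [M] be divided by 4. *)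
Context (h : A) (h2 : h *+ 2 = 1).

(** The quantifier over q is what makes this set stable under multiplication. *)
Lemma bounded_closed v : sum_of_squares v ->
  ideal_closed [set p | forall q, exists2 N, (0 < N)%N & M (v *+ N + q * p)].
Proof.
move=> v0; split=> [q|a b /= Ba Bb q|a b /= Bb q].
- exists 1%N => //; rewrite mulr0 addr0; exact: qm_sos.
- have [N N0 Na] := Ba q; have [N' N'0 Nb] := Bb q.
  exists (N + N')%N; first by rewrite addn_gt0 N0.
  by rewrite mulrDr mulrnDr addrACA; exact: qmD.
- by have [N N0 Nb] := Bb (q * a); exists N => //; rewrite mulrA.
Qed.

(** If v - a^2 and v - b^2 are sums of squares and N + q, N - q lie in M, then
    4 q a b = q (a + b)^2 - q (a - b)^2 is bounded below by
    - N ((a + b)^2 + (a - b)^2) = - 2 N (a^2 + b^2), hence by - 4 N v. *)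
Lemma dominated_bounded v p : sum_of_squares v -> p \isin dominated_ideal v ->
  exists2 N, (0 < N)%N & M (v *+ N + p).
Proof.
move=> v0 vp.
suff /(_ p vp 1) : dominated_ideal v `<=` Ideal (bounded_closed v0).
  by rewrite mul1r.
apply: ideal_gen_min => _ [a va [b vb <-]] q /=.
have [N N0 [Nq Nq']] := M_arch q; exists N => //.
have -> : v *+ N + q * (a * b) = h ^+ 2 *
    ((a + b) ^+ 2 * (N%:R + q) + (a - b) ^+ 2 * (N%:R - q)
     + ((v - a ^+ 2) + (v - b ^+ 2)) *+ (2 * N)).
  have -> : (a + b) ^+ 2 * (N%:R + q) + (a - b) ^+ 2 * (N%:R - q)
     + ((v - a ^+ 2) + (v - b ^+ 2)) *+ (2 * N) = 2 ^+ 2 * (v *+ N + q * (a * b)).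
    rewrite -[_ *+ (2 * N)]mulr_natr -[v *+ N]mulr_natr natrM; ring.
  by rewrite mulrA -exprMn mulr_natr h2 expr1n mul1r.
apply: qmX; apply: qmD; first by apply: qmD; exact: qmX.
by apply/qmMn/qmD; exact: qm_sos.
Qed.

End QuadraticModule.
End Domination.

(** * Pure states on modules with an order unit *)
Lemma quadratic_ge0_discriminant (K : realFieldType) (a b c : K) : 0 <= c ->
  (forall r, 0 <= a + r * b *+ 2 + r ^+ 2 * c) -> b ^+ 2 <= a * c.
Proof.
move=> c_ge0 h; case: (eqVneq c 0) => [c0|c0].
  rewrite c0 mulr0; case: (eqVneq b 0) => [->|b0]; first by rewrite expr0n.
  have := h (- (a + 1) / (b * 2)); rewrite c0 mulr0 addr0.
  have -> : a + - (a + 1) / (b * 2) * b *+ 2 = -1 by field.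
  by rewrite lerNr oppr0 ler10.
have cp : 0 < c by rewrite lt_def c0.
have := h (- b / c).
have -> : a + - b / c * b *+ 2 + (- b / c) ^+ 2 * c = (a * c - b ^+ 2) / c by field.
by rewrite pmulr_lge0 ?invr_gt0// subr_ge0.
Qed.

(** If t 0 = 1 + d with d > 0, repeated squaring makes t j grow at least like
    1 + (j + 1) d. *)
Lemma squaring_bounded_le1 (K : archiRealFieldType) (t : nat -> K) (B : K) :
  (forall j, t j ^+ 2 <= t j.+1) -> (forall j, t j <= B) -> t 0%N <= 1.
Proof.
move=> tS tB; rewrite leNgt; apply/negP => t1.
set d := t 0%N - 1; have d0 : 0 < d by rewrite subr_gt0.
have td j : 1 + j.+1%:R * d <= t j.
  elim: j => [|j IH]; first by rewrite mul1r /d addrC subrK.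
  apply: le_trans (tS j).
  have j0 : (0 : K) <= j%:R by [].
  have : (1 + j.+1%:R * d) ^+ 2 <= t j ^+ 2.
    by rewrite ler_sqr ?nnegrE ?addr_ge0 ?mulr_ge0 ?(ltW d0)//;
      apply: le_trans IH; rewrite ?addr_ge0 ?mulr_ge0 ?(ltW d0).
  apply: le_trans; rewrite -[j.+2]addn2 -[j.+1]addn1 !natrD; nra.
have B0 : 0 <= B by apply: le_trans (tB 0%N); rewrite ltW// (lt_trans _ t1).
have := archi_boundP (divr_ge0 B0 (ltW d0)); set N := Num.bound _.
rewrite ltr_pdivrMr// => BN; have := le_trans (td N) (tB N).
rewrite -[N.+1]addn1 natrD; nra.
Qed.

(** A is a K-algebra through [c], and [act] makes V an A-module. The A-action is a
    function rather than a second module structure, so that the only module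
    structure on V is the real one in which states are defined. *)
Section PureStates.
Context (K : realType) (A : comNzRingType) (c : {rmorphism K -> A}).
Context (M : set A) (M_qm : quadratic_module M) (M_arch : archimedean_qm M).
Context (V : lmodType K) (act : A -> V -> V).
Hypothesis actDl : forall a b v, act (a + b) v = act a v + act b v.
Hypothesis actDr : forall a v w, act a (v + w) = act a v + act a w.
Hypothesis actM : forall a b v, act (a * b) v = act a (act b v).
Hypothesis actZ : forall r v, act (c r) v = r *: v.
Context (C : set V) (u : V).
Hypothesis CX : forall a v, C v -> C (act (a ^+ 2) v).
Hypothesis Cu : forall a, M a -> C (act a u).
Hypothesis u_unit : unit_for C u.

Lemma half_dbl : c (2^-1) *+ 2 = 1.
Proof. by rewrite -rmorphMn /= -mulr_natr mulVf ?rmorph1 ?pnatr_eq0. Qed.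

Lemma act1 v : act 1 v = v.
Proof. by rewrite -(rmorph1 c) actZ scale1r. Qed.

Section State.
Context (phi : V -> K^o) (phi_state : states C u phi).

Lemma stateD v w : phi (v + w) = phi v + phi w.
Proof.
by case: phi_state => lin _ _; have := lin 1 v w; rewrite scale1r mul1r.
Qed.

Lemma state0 : phi 0 = 0.
Proof. by apply: (addrI (phi 0)); rewrite -stateD !addr0. Qed.

Lemma stateZ r v : phi (r *: v) = r * phi v.
Proof.
by case: phi_state => lin _ _; have := lin r v 0; rewrite !addr0 state0 addr0.
Qed.

Lemma state_ge0 v : C v -> 0 <= phi v.
Proof. by case: phi_state => _ h _; exact: h. Qed.

Lemma state_unit : phi u = 1.
Proof. by case: phi_state. Qed.

Lemma stateZl r a v : phi (act (c r * a) v) = r * phi (act a v).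
Proof. by rewrite actM actZ stateZ. Qed.

Lemma stateDl a b v : phi (act (a + b) v) = phi (act a v) + phi (act b v).
Proof. by rewrite actDl stateD. Qed.

Lemma stateBl a b v : phi (act (a - b) v) = phi (act a v) - phi (act b v).
Proof.
by rewrite -mulN1r -(rmorph1 c) -rmorphN stateDl stateZl mulN1r.
Qed.

Lemma state_sqr_ge0 a v : C v -> 0 <= phi (act (a ^+ 2) v).
Proof. by move=> Cv; apply/state_ge0/CX. Qed.

Lemma state_cauchy_schwarz a v : C v ->
  phi (act a v) ^+ 2 <= phi (act (a ^+ 2) v) * phi v.
Proof.
move=> Cv; apply: quadratic_ge0_discriminant => [|r]; first exact: state_ge0.
have := state_sqr_ge0 (a + c r) Cv.
have -> : (a + c r) ^+ 2 = a ^+ 2 + (c r * a + c r * a) + c (r ^+ 2) * 1.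
  by rewrite rmorphXn; ring.
by rewrite !stateDl !stateZl act1 -mulr2n.
Qed.

Lemma stateZr r a v : phi (act a (r *: v)) = r * phi (act a v).
Proof. by rewrite -actZ -actM mulrC stateZl. Qed.

Lemma qm_sub_power a m : M (1 - a ^+ 2) -> M (1 - (a ^+ m) ^+ 2).
Proof.
move=> Ma; elim: m => [|m IH]; first by rewrite expr1n subrr; case: M_qm.
have -> : 1 - (a ^+ m.+1) ^+ 2 = (1 - (a ^+ m) ^+ 2) + (a ^+ m) ^+ 2 * (1 - a ^+ 2).
  by rewrite [a ^+ m.+1]exprSr; ring.
by apply: qmD => //; exact: qmX.
Qed.

(** Some N u - v lies in C, so the values at the squares b^2 v are at most N times
    the values at b^2 u, which are at most 1 because 1 - b^2 lies in M for every
    power b of a. *)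
Lemma state_power_le a v : M (1 - a ^+ 2) -> C v ->
  exists B, forall j, phi (act (a ^+ (2 ^ j.+1)) v) <= B.
Proof.
move=> Ma Cv; have [N N0 CN] := u_unit (- v); exists N%:R => j.
have -> : a ^+ (2 ^ j.+1) = (a ^+ (2 ^ j)) ^+ 2 by rewrite -exprM expnSr.
set b := a ^+ _; have := state_sqr_ge0 b CN.
rewrite actDr stateD -scaler_nat -(scaleN1r v) !stateZr mulN1r subr_ge0.
move=> /le_trans; apply; rewrite -[leRHS]mulr1 ler_pM2l ?ltr0n//.
have /Cu/state_ge0 := qm_sub_power (2 ^ j) Ma.
by rewrite stateBl act1 state_unit subr_ge0.
Qed.

(** The factor 1 - a^2 lies in M, but M need not map C into itself, so positivity
    on (1 - a^2) v is not immediate. If phi v = 0, Cauchy-Schwarz gives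
    phi (a^2 v) = 0. Otherwise it shows that each of the ratios
    phi (a^(2^j) v) / phi v, j >= 1, is at least the square of the one before; as
    they stay bounded, the first is at most 1. *)
Lemma state_sqr_le a v : M (1 - a ^+ 2) -> C v ->
  phi (act (a ^+ 2) v) <= phi v.
Proof.
move=> Ma Cv; have [B hB] := state_power_le Ma Cv.
have v0 := state_ge0 Cv.
case: (eqVneq (phi v) 0) => [v00|v00].
  have := state_cauchy_schwarz (a ^+ 2) Cv; rewrite v00 mulr0 => h.
  suff /eqP -> : phi (act (a ^+ 2) v) == 0 by [].
  by rewrite -sqrf_eq0 eq_le h sqr_ge0.
have vp : 0 < phi v by rewrite lt_def v00.
rewrite -(mul1r (phi v)) -ler_pdivrMr//.
pose t j := phi (act (a ^+ (2 ^ j.+1)) v) / phi v.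
apply: (@squaring_bounded_le1 _ t (B / phi v)) => j; last first.
  by rewrite /t ler_pM2r ?invr_gt0.
have := state_cauchy_schwarz (a ^+ (2 ^ j.+1)) Cv.
rewrite -exprM -expnSr => h.
rewrite /t ler_pdivlMr//.
have -> (x : K) : (x / phi v) ^+ 2 * phi v = x ^+ 2 / phi v by field.
by rewrite ler_pdivrMr.
Qed.

End State.

Section Pure.
Context (phi : V -> K^o) (phi_pure : pure_states C u phi).

Lemma pure_state_state : states C u phi.
Proof. by case: phi_pure. Qed.
Local Notation ps := pure_state_state.

Lemma scaled_state a s : 0 < s -> phi (act a u) = s ->
  (forall v, C v -> 0 <= phi (act a v)) ->
  states C u ((fun v => s^-1 * phi (act a v)) : V -> K^o).
Proof.
move=> s0 us aC; split=> [r v w|v Cv|].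
- by rewrite actDr (stateD ps) (stateZr ps) mulrDr mulrCA.
- by rewrite mulr_ge0 ?invr_ge0 ?(ltW s0) ?aC.
- by rewrite us mulVf// gt_eqF.
Qed.

(** The functionals phi ((1 + a^2) -) and phi ((2 - a^2) -) are nonnegative on C
    and add up to 3 phi. The added constants keep their values at u positive, so
    both can be normalised to states without a case distinction, and extremality
    makes the first of them a multiple of phi. *)
Lemma pure_state_sqr_bounded a v : M (1 - a ^+ 2) ->
  phi (act (a ^+ 2) v) = phi (act (a ^+ 2) u) * phi v.
Proof.
move=> Ma; have [_ ext] := phi_pure.
pose w := 1 + a ^+ 2; pose w' := 1 + (1 - a ^+ 2).
have wE x : phi (act w x) = phi x + phi (act (a ^+ 2) x).
  by rewrite (stateDl ps) act1.
have wE' x : phi (act w' x) = phi x + (phi x - phi (act (a ^+ 2) x)).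
  by rewrite (stateDl ps) act1 (stateBl ps) act1.
have C1 : C u by case: M_qm => _ /Cu; rewrite act1.
have wC x : C x -> 0 <= phi (act w x).
  by move=> Cx; rewrite wE addr_ge0 ?(state_ge0 ps Cx) ?(state_sqr_ge0 ps _ Cx).
have wC' x : C x -> 0 <= phi (act w' x).
  by move=> Cx; rewrite wE' addr_ge0 ?(state_ge0 ps Cx)// subr_ge0 (state_sqr_le ps Ma).
set s := phi (act w u); set s' := phi (act w' u).
have a0 := state_sqr_ge0 ps a C1; have a1 := state_sqr_le ps Ma C1.
have u1 := state_unit ps.
have s1 : 0 < s by rewrite /s wE; lra.
have s1' : 0 < s' by rewrite /s' wE'; lra.
have ss : s + s' = 3 by rewrite /s /s' wE wE'; lra.
have t01 : 0 < s / 3 < 1 by lra.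
have [|/(congr1 (fun f => f v)) /= h _] := ext _ _ _ (scaled_state s1 erefl wC)
  (scaled_state s1' erefl wC') t01.
  apply/funext => x; rewrite /= !fctE /GRing.scale /=.
  have -> : 1 - s / 3 = s' / 3 by lra.
  have cancel (r y : K) : 0 < r -> r / 3 * (r^-1 * y) = y / 3.
    by move=> r0; field; rewrite gt_eqF.
  rewrite !cancel// wE wE'; lra.
move/(congr1 (fun y => s * y)): h; rewrite mulrA divff ?gt_eqF// mul1r wE /s wE u1.
by rewrite mulrDl mul1r => /addrI.
Qed.

(** Some N - a^2 lies in M; rescaling a by 1 / N gives the bounded case. *)
Lemma pure_state_sqr a v : phi (act (a ^+ 2) v) = phi (act (a ^+ 2) u) * phi v.
Proof.
have [N N0 [_ Na]] := M_arch (a ^+ 2).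
have N0' : N%:R != 0 :> K by rewrite pnatr_eq0 -lt0n.
pose r : K := N%:R^-1.
have rN : c r * N%:R = 1 by rewrite -(rmorph_nat c) -rmorphM mulVf// rmorph1.
have : M (1 - (c r * a) ^+ 2).
  have -> : 1 - (c r * a) ^+ 2 = c r ^+ 2 * ((N * N.-1)%:R + (N%:R - a ^+ 2)).
    rewrite natrM -subn1 natrB// -[X in X - _](expr1n A 2) -{1}rN; ring.
  by apply/(qmX M_qm)/(qmD M_qm) => //; exact: qm_nat.
move=> /(pure_state_sqr_bounded v).
have -> : (c r * a) ^+ 2 = c (r ^+ 2) * a ^+ 2 by rewrite exprMn rmorphXn.
rewrite !(stateZl ps) -[RHS]mulrA.
by move/(@mulfI K); apply; rewrite expf_neq0// invr_eq0.
Qed.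

(** The squares determine the general case, as 4 a = (a + 1)^2 - (a - 1)^2. *)
Lemma pure_state_mul a v : phi (act a v) = phi (act a u) * phi v.
Proof.
have -> : a = c (4^-1) * ((a + 1) ^+ 2 - (a - 1) ^+ 2).
  have -> : (a + 1) ^+ 2 - (a - 1) ^+ 2 = a * 4 by ring.
  by rewrite mulrCA -(rmorph_nat c) -rmorphM mulVf ?pnatr_eq0// rmorph1 mulr1.
rewrite !(stateZl ps) !(stateBl ps).
rewrite (pure_state_sqr (a + 1) v) (pure_state_sqr (a - 1) v); ring.
Qed.
End Pure.
End PureStates.

(** * Standard parts *)
Section StandardPart.
Context (K : realType) (R : rcfType) (iota : {rmorphism K -> R}).
Implicit Types (a b : fin R) (r s : K).

Lemma iota_lt r s : (iota r < iota s) = (r < s).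
Proof. by rewrite !lt_neqAle iota_le fmorph_eq. Qed.

Lemma iota_norm r : iota `|r| = `|iota r|.
Proof.
case: (ger0P r) => r0; first by rewrite ger0_norm// -(rmorph0 iota) iota_le.
by rewrite rmorphN ltr0_norm// -(rmorph0 iota) iota_lt.
Qed.

Lemma infinitesimalP (a : R) :
  infinitesimal a <-> forall e : K, 0 < e -> `|a| <= iota e.
Proof.
split=> [a0 e e0|a0 N N0].
  have := archi_boundP (ltW (eq_ind_r is_true e0 (invr_gt0 e))).
  set N := Num.bound _ => eN; have N0 : 0 < N%:R :> K.
    by apply: lt_trans eN; rewrite invr_gt0.
  have /a0 : (0 < N)%N by rewrite -(ltr0n K).
  rewrite -ler_norml => /le_trans; apply.
  by rewrite -(rmorph_nat iota) -fmorphV iota_le invf_ple// ltW.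
rewrite -ler_norml; have /a0 : 0 < N%:R^-1 :> K by rewrite invr_gt0 ltr0n.
by rewrite fmorphV rmorph_nat.
Qed.

Lemma infinitesimal0 : infinitesimal (0 : R).
Proof.
apply/infinitesimalP => e e0.
by rewrite normr0 -(rmorph0 iota) iota_le ltW.
Qed.

Lemma infinitesimalD (a b : R) :
  infinitesimal a -> infinitesimal b -> infinitesimal (a + b).
Proof.
move=> /infinitesimalP a0 /infinitesimalP b0; apply/infinitesimalP => e e0.
have e2 : 0 < e / 2 by rewrite divr_gt0.
rewrite (le_trans (ler_normD _ _))// [e]splitr rmorphD.
by apply: lerD; [exact: a0|exact: b0].
Qed.

Lemma infinitesimalMl (a b : R) : a \in @is_finite R ->
  infinitesimal b -> infinitesimal (a * b).
Proof.
move=> /is_finiteP[N N0 aN] /infinitesimalP b0; apply/infinitesimalP => e e0.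
have N0' : 0 < N%:R :> K by rewrite ltr0n.
have /b0 bN : 0 < e / N%:R by rewrite divr_gt0.
rewrite normrM (le_trans (ler_pM _ _ aN bN))//.
by rewrite rmorphM fmorphV rmorph_nat mulrCA divff ?mulr1// pnatr_eq0 -lt0n.
Qed.

(** Unlike [st], which is defined on the whole field, its restriction to the
    finite elements is a ring morphism. *)
Definition stf a : K := st iota (finval a).

Lemma stf_infinitesimal a : infinitesimal (finval a - iota (stf a)).
Proof. exact/st_infinitesimal/finvalP. Qed.

Lemma stf_uniq a r : infinitesimal (finval a - iota r) -> stf a = r.
Proof. exact/infinitesimal_std_uniq/stf_infinitesimal. Qed.

Fact stf_zmod : zmod_morphism stf.
Proof.
move=> a b; apply: stf_uniq; rewrite /= rmorphB.
have -> : finval a - finval b - (iota (stf a) - iota (stf b))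
  = (finval a - iota (stf a)) + (-1) * (finval b - iota (stf b)) by ring.
apply: infinitesimalD; first exact: stf_infinitesimal.
apply: infinitesimalMl; last exact: stf_infinitesimal.
by apply/is_finiteP; exists 1%N; rewrite ?normrN ?normr1.
Qed.

Fact stf_monoid : monoid_morphism stf.
Proof.
split=> [|a b]; apply: stf_uniq.
  by rewrite rmorph1 subrr; exact: infinitesimal0.
rewrite /= rmorphM.
have -> : finval a * finval b - iota (stf a) * iota (stf b)
  = finval a * (finval b - iota (stf b))
    + iota (stf b) * (finval a - iota (stf a)) by ring.
apply: infinitesimalD; apply: infinitesimalMl; rewrite ?iota_finite ?finvalP//;
  exact: stf_infinitesimal.
Qed.

HB.instance Definition _ :=
  GRing.isZmodMorphism.Build (fin R) K stf stf_zmod.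
HB.instance Definition _ :=
  GRing.isMonoidMorphism.Build (fin R) K stf stf_monoid.

Lemma stf_real r : stf (fin_real iota r) = r.
Proof. by apply: stf_uniq; rewrite subrr; exact: infinitesimal0. Qed.

Lemma fin_unit a : stf a != 0 -> exists b, a * b = 1.
Proof.
move=> sa.
have e0 : 0 < `|stf a| / 2 by rewrite divr_gt0// normr_gt0.
have ea : iota (`|stf a| / 2) <= `|finval a|.
  have /infinitesimalP/(_ _ e0) h := stf_infinitesimal a.
  have : iota `|stf a| <= `|finval a| + `|finval a - iota (stf a)|.
    rewrite iota_norm -[X in `|X|](subKr (finval a)).
    exact: ler_normB.
  move/le_trans/(_ (lerD (lexx _) h)).
  by rewrite {1}(splitr `|stf a|) rmorphD lerD2r.
have ia0 : 0 < iota (`|stf a| / 2) by rewrite -(rmorph0 iota) iota_lt.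
have fa : (finval a)^-1 \in @is_finite R.
  apply/is_finiteP; exists (Num.bound (`|stf a| / 2)^-1).
    by rewrite -(ltr0n K) (lt_trans _ (archi_boundP _)) ?invr_ge0 ?invr_gt0 ?(ltW e0).
  rewrite normfV -(rmorph_nat iota) (le_trans (y := iota (`|stf a| / 2)^-1))//.
    by rewrite [leRHS]fmorphV lef_pV2 ?posrE// (lt_le_trans ia0).
  by rewrite iota_le ltW// archi_boundP// invr_ge0 ltW.
exists (Fin fa); apply: val_inj; rewrite /= mulfV// -normr_gt0.
exact: lt_le_trans ea.
Qed.

Lemma st_quotient a b : stf b != 0 ->
  st iota (finval a / finval b) = stf a / stf b.
Proof.
move=> sb; have [b' bb'] := fin_unit sb.
have b0 : finval b != 0.
  by apply: contra_neq (oner_neq0 R) => b0; rewrite -[1]/(finval 1) -bb' /= b0 mul0r.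
have -> : finval a / finval b = finval (a * b').
  apply: (mulIf b0); rewrite divfK// /= -mulrA.
  by rewrite -[finval b' * _]/(finval (b' * b)) [b' * b]mulrC bb' /= mulr1.
rewrite -/(stf (a * b')) rmorphM; congr (_ * _); apply: (mulfI sb).
by rewrite -rmorphM bb' rmorph1 divff.
Qed.

Lemma fin_sqrt a : 0 <= finval a -> exists b, a = b ^+ 2.
Proof.
move=> a0; have /is_finiteP[N N0 aN] := finvalP a.
have fa : Num.sqrt (finval a) \in @is_finite R.
  apply/is_finiteP; exists N => //; rewrite ger0_norm ?sqrtr_ge0//.
  rewrite -(ler_sqr (x := Num.sqrt _)) ?nnegrE ?sqrtr_ge0// sqr_sqrtr//.
  apply: le_trans (ler_norm _) (le_trans aN _).
  by rewrite -natrX ler_nat -{1}(expn1 N) leq_pexp2l.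
by exists (Fin fa); apply: val_inj; rewrite /= -expr2 sqr_sqrtr.
Qed.

(** Nonnegative finite elements are squares of finite elements, so a ring morphism
    to K that fixes K is monotone, hence kills the infinitesimals. *)
Lemma fin_character (Phi : {rmorphism fin R -> K}) :
  (forall r, Phi (fin_real iota r) = r) -> Phi =1 stf.
Proof.
move=> PhiK a; pose e := a - fin_real iota (stf a).
have e0 : infinitesimal (finval e) by exact: stf_infinitesimal.
suff Pe b : infinitesimal (finval b) -> Phi b <= 0.
  apply/eqP; rewrite -subr_eq0 -[stf a]PhiK -rmorphB -/e eq_le Pe//=.
  rewrite -oppr_le0 -rmorphN Pe//.
  by move=> N N0; rewrite /= -ler_norml normrN ler_norml; exact: e0.
move=> {}e0.
rewrite leNgt; apply/negP => b0.
have [c bc] : exists c, fin_real iota (Phi b / 2) - b = c ^+ 2.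
  apply: fin_sqrt; rewrite /= subr_ge0.
  by apply: le_trans (ler_norm _) _; move/infinitesimalP: e0; apply; rewrite divr_gt0.
have := sqr_ge0 (Phi c); rewrite -rmorphXn -bc rmorphB PhiK /=; lra.
Qed.

End StandardPart.

(** * Positive semidefinite matrices *)
(** Splitting off one variable: with C = (a, b; b^T, D), nonnegativity of C on
    the vectors (r, w) bounds (b w^T)^2 by a (w D w^T), so the Schur complement
    D - b^T b / a is again positive semidefinite, and b = 0 when a = 0. *)
Lemma psd_sum_rank_one (K : rcfType) (n : nat) (C : 'M[K]_n) :
  C^T = C -> (forall w : 'rV_n, 0 <= (w *m C *m w^T) 0 0) ->
  exists v : 'I_n -> 'rV[K]_n, C = \sum_l (v l)^T *m v l.
Proof.
elim: n C => [|n IH] C Csym Cpsd.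
  by exists (fun=> 0); rewrite big_ord0; apply/matrixP => -[].
rewrite -[n.+1]/(1 + n)%N in C Csym Cpsd *.
set a := C 0 0; set b := ursubmx C; set D := drsubmx C.
have aE : ulsubmx C = a%:M.
  by rewrite [LHS]mx11_scalar !mxE; congr (C _ _)%:M; apply: val_inj.
have bE : dlsubmx C = b^T by rewrite /b trmx_ursub Csym.
have CE : C = block_mx a%:M b b^T D by rewrite -aE -bE submxK.
have Dsym : D^T = D by rewrite /D trmx_drsub Csym.
have key (w : 'rV_n) r :
    0 <= (w *m D *m w^T) 0 0 + r * (b *m w^T) 0 0 *+ 2 + r ^+ 2 * a.
  have := Cpsd (row_mx r%:M w).
  rewrite CE mul_row_block tr_row_mx mul_row_col tr_scalar_mx !mulmxDl.
  rewrite -scalar_mxM !mul_scalar_mx !mul_mx_scalar -scalemxAl.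
  have -> : w *m b^T = (b *m w^T)^T by rewrite trmx_mul trmxK.
  rewrite !mxE /= !mulr1n; congr (0 <= _); ring.
have a0 : 0 <= a.
  have := key 0 1; rewrite !mul0mx trmx0 mulmx0 !mxE mulr0 mul0rn.
  by rewrite !add0r expr1n mul1r.
have cs w := quadratic_ge0_discriminant a0 (key w).
have b0 : a = 0 -> b = 0.
  move=> a00; apply/rowP => j; have := cs (delta_mx 0 j).
  rewrite a00 mulr0 trmx_delta -colE !mxE => h; apply/eqP.
  by rewrite -sqrf_eq0 eq_le h sqr_ge0.
pose D' := D - a^-1 *: (b^T *m b).
have [||v' v'E] := IH D'.
- by rewrite /D' linearB/= linearZ/= trmx_mul trmxK Dsym.
- move=> w; rewrite /D' mulmxBr mulmxBl -scalemxAr -scalemxAl.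
  have -> : w *m (b^T *m b) *m w^T = (b *m w^T)^T *m (b *m w^T).
    by rewrite trmx_mul trmxK !mulmxA.
  set s := b *m w^T; rewrite !mxE big_ord1 !mxE -expr2 subr_ge0.
  case: (eqVneq a 0) => [->|a_neq0].
    by have := key w 0; rewrite invr0 expr0n !mul0r mul0rn !addr0 mxE.
  by rewrite mulrC ler_pdivrMr ?lt_def ?a_neq0//;
    have := cs w; rewrite !mxE.
(* As 0^-1 = 0, this vector is 0 when a = 0. *)
pose v0 : 'rV[K]_(1 + n) := row_mx (Num.sqrt a)%:M ((Num.sqrt a)^-1 *: b).
exists (fun l => oapp (fun j => row_mx 0 (v' j)) v0 (unlift 0 l)).
rewrite big_ord_recl unlift_none /=.
under eq_bigr => j _ do rewrite liftK /= tr_row_mx mul_col_row trmx0 !mul0mx mulmx0.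
have blockE (X Y : 'M[K]_n) :
    block_mx (0 : 'M_1) 0 0 (X + Y) = block_mx 0 0 0 X + block_mx 0 0 0 Y.
  by rewrite add_block_mx !addr0.
rewrite -(big_morph _ blockE (block_mx_const _ _ _ _ 0)) -v'E.
rewrite /v0 tr_row_mx mul_col_row add_block_mx !addr0 CE.
rewrite tr_scalar_mx !linearZ/= -!scalemxAl !mul_scalar_mx !mul_mx_scalar.
have sb : (Num.sqrt a / Num.sqrt a) *: b = b.
  case: (eqVneq a 0) => [/b0->|a_neq0]; first by rewrite scaler0.
  by rewrite divff ?scale1r// sqrtr_eq0 -ltNge lt_def a_neq0.
congr block_mx.
- by rewrite scale_scalar_mx -expr2 sqr_sqrtr.
- by rewrite scalerA mulrC sb.
- by rewrite scalerA mulrC -[in RHS]linearZ/= sb.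
- by rewrite !scalerA -expr2 exprVn sqr_sqrtr// addrC subrK.
Qed.

(** * Polynomials at a point *)
Section CenteredVariables.
Context (S : comNzRingType) (n : nat).
Local Notation poly := {mpoly S[n]}.
Implicit Types (y z : 'I_n -> S) (p q : poly).

Definition centered_var y (l : 'I_n) : poly := 'X_l - (y l)%:MP.

Lemma meval_centered_var y z l : (centered_var y l).@[z] = z l - y l.
Proof. by rewrite mevalB mevalXU mevalC. Qed.

(** The polynomials congruent modulo J to their value at y form a subring that
    contains the constants and the variables. *)
Lemma sub_meval_ideal y (J : ideal poly) p :
  (forall l, centered_var y l \isin J) -> p - (p.@[y])%:MP \isin J.
Proof.
move=> JY; have J0 : 0 \isin J by case: (idealP J).
pose T := [set p | p - (p.@[y])%:MP \isin J].
have TC c : T c%:MP by rewrite /T /= mevalC subrr.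
have TD p1 p2 : T p1 -> T p2 -> T (p1 + p2).
  by rewrite /T /= mevalD mpolyCD opprD addrACA; exact: idealD.
have TM p1 p2 : T p1 -> T p2 -> T (p1 * p2).
  rewrite /T /= => T1 T2.
  have -> : p1 * p2 - ((p1 * p2).@[y])%:MP
    = p2 * (p1 - (p1.@[y])%:MP) + (p1.@[y])%:MP * (p2 - (p2.@[y])%:MP).
    by rewrite mevalM mpolyCM; ring.
  by apply: idealD; exact: idealMl.
have T0 : T 0 by rewrite -mpolyC0; exact: TC.
have T1 : T 1 by rewrite -mpolyC1; exact: TC.
rewrite -/(T p) (mpolyE p); apply: (big_ind T T0 TD) => m _.
rewrite -mul_mpolyC; apply: (TM _ _ (TC _)); rewrite mpolyXE_id.
apply: (big_ind T T1 TM) => l _; elim: (m l) => [|e IH]; first by rewrite expr0.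
by rewrite exprS; apply: TM => //; rewrite /T /= mevalXU; exact: JY.
Qed.

Lemma mderiv_centered_var y l a : mderiv a (centered_var y l) = ((a == l)%:R)%:MP.
Proof.
rewrite mderivB mderivC subr0 mderivX mnm1E eq_sym.
case: eqVneq => [->|_]; last by rewrite scale0r mpolyC0.
have -> : (U_(l) - U_(l) = 0)%MM by apply/mnmP => i; rewrite mnmBE subnn mnm0E.
by rewrite scale1r mpolyX0.
Qed.

(** At a common zero of p and r only the terms in which each of the two factors
    is differentiated once survive. *)
Lemma mderiv2_mul_vanishing y q p r a b : p.@[y] = 0 -> r.@[y] = 0 ->
  (mderiv a (mderiv b (q * (p * r)))).@[y]
    = q.@[y] * ((mderiv a p).@[y] * (mderiv b r).@[y]
                + (mderiv b p).@[y] * (mderiv a r).@[y]).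
Proof.
move=> p0 r0; rewrite !mderivM !(mderivD, mderivM) !(mevalD, mevalM) p0 r0.
ring.
Qed.

End CenteredVariables.

Section FinPolynomials.
Context (K : realType) (R : rcfType) (iota : {rmorphism K -> R}) (n : nat).
Local Notation poly := {mpoly (fin R)[n]}.
Local Notation stf := (stf iota).
Implicit Types (x y z : 'I_n -> fin R) (p q : poly).

Lemma vanishing_ideal_gen y :
  vanishing_ideal y `<=` ideal_gen (range (centered_var y)).
Proof.
move=> p /= p0; have := @sub_meval_ideal _ _ y (ideal_gen (range (centered_var y))) p.
by rewrite p0 mpolyC0 subr0; apply=> l; apply: ideal_gen_incl; exists l.
Qed.

Lemma centered_var_vanishing y l : centered_var y l \isin vanishing_ideal y.
Proof. by rewrite /= meval_centered_var subrr. Qed.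

Definition vanishing_sq y := ideal_mul (vanishing_ideal y) (vanishing_ideal y).

Lemma vanishing_sq_min y (J : ideal poly) :
  (forall l m, centered_var y l * centered_var y m \isin J) ->
  vanishing_sq y `<=` J.
Proof.
move=> JY; have V := @vanishing_ideal_gen y.
apply: (subset_trans (ideal_mulS V V)); apply: ideal_mul_gen_min.
by move=> _ _ [l _ <-] [m _ <-]; exact: JY.
Qed.

Lemma centered_var_mul_sq y l m :
  centered_var y l * centered_var y m \isin vanishing_sq y.
Proof. by apply: ideal_mul_mem; exact: centered_var_vanishing. Qed.

(** Some coordinate of z - y has nonzero standard part, hence is a unit, and it is
    the difference of the corresponding generators of the two ideals. *)
Lemma vanishing_comaximal y z : st_pt iota y <> st_pt iota z ->
  comaximal (vanishing_ideal y) (vanishing_ideal z).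
Proof.
move=> yz.
have [l yzl] : exists l, stf (z l - y l) != 0.
  apply: contrapT => h; apply: yz; apply/funext => l; apply/eqP.
  apply: contrapT => /negP yzl; apply: h; exists l.
  by rewrite rmorphB subr_eq0 eq_sym.
have [b bE] := fin_unit yzl.
exists (b%:MP * centered_var y l).
  by apply: idealMl; exact: centered_var_vanishing.
rewrite /= mevalB mevalM !mevalC meval_centered_var.
by rewrite mulrC bE subrr.
Qed.

Lemma sqdist_polyE y : sqdist_poly y = \sum_l centered_var y l ^+ 2.
Proof. by []. Qed.

Lemma sos_sqdist y : sum_of_squares (sqdist_poly y).
Proof. by apply: sos_sum => l _; exact: sos_sqr. Qed.

Lemma sqdist_vanishing_sq y : sqdist_poly y \isin vanishing_sq y.
Proof.
rewrite sqdist_polyE; apply: (big_ind (fun p => p \isin vanishing_sq y)).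
- by case: (idealP (vanishing_sq y)).
- by move=> p q; exact: idealD.
- by move=> l _; rewrite expr2; exact: centered_var_mul_sq.
Qed.

Lemma dominates_sqdist y l : dominates (sqdist_poly y) (centered_var y l).
Proof.
rewrite /dominates sqdist_polyE (bigD1 l)//= addrC addrK.
by apply: sos_sum => m _; exact: sos_sqr.
Qed.

Lemma vanishing_sq_dominated y :
  vanishing_sq y `<=` dominated_ideal (sqdist_poly y).
Proof.
apply: vanishing_sq_min => l m; apply: ideal_gen_incl.
exists (centered_var y l); first exact: dominates_sqdist.
by exists (centered_var y m) => //; exact: dominates_sqdist.
Qed.

Lemma stf_sqdist y z :
  stf (sqdist_poly y).@[z] = \sum_l (stf (z l) - stf (y l)) ^+ 2.
Proof.
rewrite sqdist_polyE (raddf_sum (meval z)) rmorph_sum; apply: eq_bigr => l _.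
by rewrite /= !expr2 mevalM !rmorphM meval_centered_var rmorphB.
Qed.

Lemma stf_sqdist_neq0 y z : st_pt iota z <> st_pt iota y ->
  stf (sqdist_poly y).@[z] != 0.
Proof.
move=> zy; apply: contra_notN zy; rewrite stf_sqdist psumr_eq0; last first.
  by move=> l _; exact: sqr_ge0.
move=> /allP h; apply/funext => l; have := h l (mem_index_enum l).
by rewrite sqrf_eq0 subr_eq0 => /eqP.
Qed.

(** On constants the character is the standard part, so its kernel contains each
    X_l - y_l, hence the difference between p and its value at y. *)
Lemma poly_character (Phi : {rmorphism poly -> K}) y :
  (forall r, Phi (fin_real iota r)%:MP = r) ->
  (forall l, stf (y l) = Phi 'X_l) -> forall p, Phi p = stf p.@[y].
Proof.
move=> PhiK PhiX p.
have Phic c : Phi c%:MP = stf c.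
  exact: (@fin_character _ _ _ (Phi \o @mpolyC n (fin R))).
pose kerPhi : set poly := [set q | Phi q = 0].
have kerP : ideal_closed kerPhi.
  split=> [|a b /= a0 b0|a b /= b0]; rewrite /kerPhi /= ?rmorph0//.
    by rewrite rmorphD a0 b0 addr0.
  by rewrite rmorphM b0 mulr0.
have := @sub_meval_ideal _ _ y (Ideal kerP) p; rewrite /= /kerPhi /= => h.
apply/eqP; rewrite -subr_eq0 -Phic -rmorphB; apply/eqP/h => l.
by rewrite rmorphB Phic PhiX subrr.
Qed.

Definition hessian_form (C : 'M[K]_n) y p : K :=
  \sum_a \sum_b C a b * stf (mderiv a (mderiv b p)).@[y].

Lemma hessian_formD C y p q :
  hessian_form C y (p + q) = hessian_form C y p + hessian_form C y q.
Proof.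
rewrite /hessian_form -big_split; apply: eq_bigr => a _.
rewrite -big_split; apply: eq_bigr => b _.
by rewrite !mderivD mevalD (rmorphD stf) mulrDr.
Qed.

Lemma hessian_form0 C y : hessian_form C y 0 = 0.
Proof.
by apply: (addrI (hessian_form C y 0)); rewrite -hessian_formD !addr0.
Qed.

Lemma hessian_form_mul C y q l m :
  hessian_form C y (q * (centered_var y l * centered_var y m))
    = stf q.@[y] * (C l m + C m l).
Proof.
have hE a b : (mderiv a (mderiv b (q * (centered_var y l * centered_var y m)))).@[y]
   = q.@[y] * ((a == l)%:R * (b == m)%:R + (b == l)%:R * (a == m)%:R).
  by rewrite mderiv2_mul_vanishing ?meval_centered_var ?subrr//
    !mderiv_centered_var !mevalC.
have delta (f : 'I_n -> K) r : \sum_a f a * (a == r)%:R = f r.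
  rewrite (bigD1 r)//= eqxx mulr1 big1 ?addr0// => a /negbTE ->.
  by rewrite mulr0.
transitivity (stf q.@[y] *
    \sum_a ((\sum_b C a b * (b == m)%:R) * (a == l)%:R
            + (\sum_b C a b * (b == l)%:R) * (a == m)%:R)).
  rewrite mulr_sumr; apply: eq_bigr => a _.
  rewrite !mulr_suml -big_split mulr_sumr; apply: eq_bigr => b _ /=.
  rewrite hE rmorphM rmorphD !rmorphM !rmorph_nat; ring.
by rewrite big_split/= !delta.
Qed.

(** Both sides are determined by their values on the multiples of the products
    (X_l - y_l) (X_m - y_m): a functional that transforms under multiplication by
    q through the value of q at y only sees the quadratic part at y. *)
Lemma quadratic_functional (psi : poly -> K) y :
  (forall p q, p \isin vanishing_sq y -> q \isin vanishing_sq y ->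
     psi (p + q) = psi p + psi q) ->
  (forall q p, p \isin vanishing_sq y -> psi (q * p) = stf q.@[y] * psi p) ->
  let C := \matrix_(l, m) psi (centered_var y l * centered_var y m) in
  forall p, p \isin vanishing_sq y -> psi p *+ 2 = hessian_form C y p.
Proof.
move=> psiD psiM C p yp.
(* Quantifying over q makes T an ideal, so that only the generators of the square
   of the vanishing ideal have to be checked. *)
pose T := [set p | p \isin vanishing_sq y /\
  forall q, psi (q * p) *+ 2 = hessian_form C y (q * p)].
have TI : ideal_closed T.
  split=> [|a b [ya Ta] [yb Tb]|a b [yb Tb]].
  - split=> [|q]; first by case: (idealP (vanishing_sq y)).
    rewrite mulr0 hessian_form0 -[X in psi X](mul0r 0) psiM ?meval0 ?rmorph0 ?mul0r ?mul0rn//.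
    by case: (idealP (vanishing_sq y)).
  - split=> [|q]; first exact: idealD.
    rewrite mulrDr hessian_formD -Ta -Tb psiD ?mulrnDl//; exact: idealMl.
  - by split=> [|q]; [exact: idealMl|rewrite mulrA].
have [|_ /(_ 1)] := @vanishing_sq_min y (Ideal TI) _ p yp; last by rewrite mul1r.
move=> l m /=; split=> [|q]; first exact: centered_var_mul_sq.
rewrite hessian_form_mul !mxE psiM; last exact: centered_var_mul_sq.
by rewrite [centered_var y m * _]mulrC -mulr2n mulrnAr.
Qed.

Lemma hessian_form_sqdist C y q :
  hessian_form C y (q * sqdist_poly y) = stf q.@[y] * \tr C *+ 2.
Proof.
rewrite sqdist_polyE mulr_sumr.
rewrite (big_morph _ (hessian_formD C y) (hessian_form0 C y)).
rewrite /mxtrace mulr_sumr -sumrMnl; apply: eq_bigr => l _.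
by rewrite expr2 hessian_form_mul -mulr2n mulrnAr.
Qed.

(** The standard part is taken of a quotient in the large field; as its terms are
    finite, it can be computed termwise. *)
Lemma st_hessian_quotient (v : 'I_n -> 'cV[K]_n) y p (d : fin R) : stf d != 0 ->
  st iota ((\sum_(l < n) ((map_mx iota (v l))^T *m hessian_at p y
                          *m map_mx iota (v l)) 0 0) / finval d)
  = hessian_form (\sum_l v l *m (v l)^T) y p / stf d.
Proof.
move=> d0.
pose h a b := (mderiv a (mderiv b p)).@[y].
have -> : \sum_(l < n) ((map_mx iota (v l))^T *m hessian_at p y
                          *m map_mx iota (v l)) 0 0
  = finval (\sum_l \sum_b \sum_a
      fin_real iota (v l a 0) * fin_real iota (v l b 0) * h a b).
  have finval_sum (F : 'I_n -> fin R) :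
      finval (\sum_i F i) = \sum_i finval (F i).
    by apply: (big_ind2 (fun a b => finval a = b)) => // a _ b _ <- <-.
  rewrite finval_sum; apply: eq_bigr => l _.
  rewrite mxE finval_sum; apply: eq_bigr => b _.
  rewrite mxE mulr_suml finval_sum; apply: eq_bigr => a _.
  by rewrite !mxE mulrAC.
rewrite st_quotient// rmorph_sum /hessian_form; congr (_ / _).
transitivity (\sum_l \sum_b \sum_a v l a 0 * v l b 0 * stf (h a b)).
  apply: eq_bigr => l _; rewrite rmorph_sum; apply: eq_bigr => b _.
  by rewrite rmorph_sum; apply: eq_bigr => a _; rewrite !rmorphM /= !stf_real.
rewrite exchange_big [RHS]exchange_big; apply: eq_bigr => b _ /=.
rewrite exchange_big; apply: eq_bigr => a _ /=.
rewrite summxE mulr_suml; apply: eq_bigr => l _.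
by congr (_ * _); rewrite mxE big_ord1 mxE.
Qed.

End FinPolynomials.

(** * The action of polynomials on an ideal *)
Section IdealAction.
Context (K : realType) (R : rcfType) (iota : {rmorphism K -> R}) (n : nat).
Context (I : ideal {mpoly (fin R)[n]}).
Local Notation poly := {mpoly (fin R)[n]}.
Local Notation V := (ideal_space I iota).

Fact ideal_act_subproof (a : poly) (v : V) : a * poly_of v \in mem_ideal I.
Proof. by apply/asboolP/idealMl/asboolP/(poly_ofP v). Qed.

Definition ideal_act (a : poly) (v : V) : V :=
  IdealSpace iota (ideal_act_subproof a v).

Lemma ideal_actDl a b v : ideal_act (a + b) v = ideal_act a v + ideal_act b v.
Proof. by apply: val_inj; rewrite /= mulrDl. Qed.

Lemma ideal_actDr a v w : ideal_act a (v + w) = ideal_act a v + ideal_act a w.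
Proof. by apply: val_inj; rewrite /= mulrDr. Qed.

Lemma ideal_actM a b v : ideal_act (a * b) v = ideal_act a (ideal_act b v).
Proof. by apply: val_inj; rewrite /= mulrA. Qed.

Definition poly_real : {rmorphism K -> poly} :=
  (@mpolyC n (fin R) \o fin_real iota).

Lemma ideal_actZ r v : ideal_act (poly_real r) v = r *: v.
Proof. exact: val_inj. Qed.

(** Total, with value 0 outside the ideal, so that a polynomial can be fed to a
    functional on the ideal before its membership has been established. *)
Definition to_ideal (p : poly) : V := insubd 0 p.

Lemma poly_of_to_ideal p : p \isin I -> poly_of (to_ideal p) = p.
Proof. by move=> Ip; apply: insubdK; exact/asboolP. Qed.

Lemma poly_of_in (v : V) : poly_of v \isin I.
Proof. exact/asboolP/poly_ofP. Qed.

End IdealAction.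

(** * Pure states on the product of squared vanishing ideals *)
Section PureStatesOnIdeals.
Context (K : realType) (R : rcfType) (iota : {rmorphism K -> R}) (n : nat).
Local Notation poly := {mpoly (fin R)[n]}.
Context (M : set poly) (M_qm : quadratic_module M) (M_arch : archimedean_qm M).
Context (k : nat) (x_ : 'I_k -> 'I_n -> fin R).
Hypothesis x_inj : forall i j, i != j -> st_pt iota (x_ i) <> st_pt iota (x_ j).
Local Notation stf := (stf iota).
Local Notation u := (\prod_(i < k) sqdist_poly (x_ i)).
Local Notation I :=
  (\big[@ideal_mul poly / idealT poly]_(i < k) vanishing_sq (x_ i)).
Local Notation V := (ideal_space I iota).
Local Notation MI := ([set p : V | M (poly_of p)]).
Local Notation act := (@ideal_act K R iota n I).

Lemma ideal_bigcapE :
  (I : set poly) = \bigcap_(i in [set: 'I_k]) (vanishing_sq (x_ i) : set poly).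
Proof.
rewrite bigmul_comaximalE ?index_enum_uniq//; last first.
  by move=> i j ij; apply: comaximal_sq; exact/vanishing_comaximal/x_inj.
apply/seteqP; split=> p /= h i; first by move=> _; apply: h; rewrite mem_index_enum.
by move=> _; exact: h.
Qed.

Lemma mem_idealP p : p \isin I <-> forall i, p \isin vanishing_sq (x_ i).
Proof. by rewrite ideal_bigcapE; split=> h i; [exact: h|move=> _; exact: h]. Qed.

Definition cofactor_poly i : poly := \prod_(j < k | j != i) sqdist_poly (x_ j).

Lemma u_cofactor i : u = cofactor_poly i * sqdist_poly (x_ i).
Proof. by rewrite (bigD1 i)//= mulrC. Qed.

Lemma u_in_ideal : u \isin I.
Proof.
apply/mem_idealP => i; rewrite (u_cofactor i).
by apply: idealMl; exact: sqdist_vanishing_sq.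
Qed.

Lemma sos_u : sum_of_squares u.
Proof. by apply: sos_prod => i _; exact: sos_sqdist. Qed.

Definition uI : V := to_ideal _ I u.

Lemma poly_of_uI : poly_of uI = u.
Proof. exact/poly_of_to_ideal/u_in_ideal. Qed.

Lemma u_unit : unit_for MI uI.
Proof.
move=> v.
have [||N N0 MN] := dominated_bounded M_qm M_arch
  (half_dbl (poly_real iota n)) (v := u) (p := poly_of v).
- exact: sos_u.
- apply: (bigmul_dominated (F := fun i => vanishing_sq (x_ i))) (poly_of_in v).
    by move=> i; exact: sos_sqdist.
  by move=> i; exact: vanishing_sq_dominated.
exists N => //=; have -> : poly_of (uI *+ N) = poly_of uI *+ N.
  exact: (raddfMn (\val : V -> poly)).
by rewrite poly_of_uI.
Qed.

Section OnePureState.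
Context (phi : V -> K^o) (phi_pure : pure_states MI uI phi).

Let MI_sqr a v : MI v -> MI (act (a ^+ 2) v).
Proof. exact: (qmX M_qm). Qed.
Let MI_u a : M a -> MI (act a uI).
Proof. by rewrite /= poly_of_uI mulrC; exact/(qm_sosM M_qm)/sos_u. Qed.

Lemma phi_act a v : phi (act a v) = phi (act a uI) * phi v.
Proof.
exact: (pure_state_mul M_qm M_arch (@ideal_actDl _ _ _ _ _)
  (@ideal_actDr _ _ _ _ _) (@ideal_actM _ _ _ _ _) (@ideal_actZ _ _ _ _ _)
  MI_sqr MI_u u_unit phi_pure).
Qed.

Let phi_state := pure_state_state phi_pure.
Let phiD v w : phi (v + w) = phi v + phi w := stateD phi_state v w.

(** By multiplicativity [phi], a functional on the ideal, yields a ring morphism on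
    the whole polynomial ring. *)
Definition character (a : poly) : K := phi (act a uI).

Fact character_zmod : zmod_morphism character.
Proof.
move=> a b; apply: (addIr (character b)).
by rewrite subrK /character -phiD -ideal_actDl subrK.
Qed.

Fact character_monoid : monoid_morphism character.
Proof.
split=> [|a b]; rewrite /character.
  rewrite -[RHS](state_unit phi_state); congr (phi _).
  by apply: val_inj; rewrite /= mul1r.
by rewrite ideal_actM phi_act.
Qed.

HB.instance Definition _ :=
  GRing.isZmodMorphism.Build poly K character character_zmod.
HB.instance Definition _ :=
  GRing.isMonoidMorphism.Build poly K character character_monoid.

Lemma character_meval y : (forall l, stf (y l) = character 'X_l) ->
  forall p, character p = stf p.@[y].
Proof.
move=> Xy p; apply: (@poly_character _ _ iota _ character _ _ Xy) => r.
have rE : act (fin_real iota r)%:MP uI = r *: uI by exact: ideal_actZ.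
by rewrite /= /character rE (stateZ phi_state) (state_unit phi_state) mulr1.
Qed.

Definition point : 'I_n -> K := fun l => character 'X_l.

Lemma character_point p : character p = stf p.@[fin_pt iota point].
Proof. by apply: character_meval => l; rewrite stf_real. Qed.

Lemma point_nonneg p : M p -> 0 <= stf p.@[fin_pt iota point].
Proof. by rewrite -character_point => /MI_u/(state_ge0 phi_state). Qed.

(** Multiplicativity, applied with u as the scalar and [v] as the vector: this
    recovers phi from its character wherever the character does not kill u. *)
Lemma character_u v : character u * phi v = character (poly_of v).
Proof.
rewrite -phi_act /character; congr (phi _); apply: val_inj.
by rewrite /= poly_of_uI mulrC.
Qed.

Lemma meval_prod (T : Type) (r : seq T) (P : pred T) (F : T -> poly) y :
  (\prod_(i <- r | P i) F i).@[y] = \prod_(i <- r | P i) (F i).@[y].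
Proof. exact: (big_morph _ (mevalM y) (meval1 y)). Qed.

Lemma stf_u_neq0 y : (forall i, st_pt iota y <> st_pt iota (x_ i)) ->
  stf u.@[y] != 0.
Proof.
move=> yx; rewrite meval_prod rmorph_prod; apply/prodf_neq0 => i _.
exact: stf_sqdist_neq0.
Qed.

Lemma st_pt_fin (x : 'I_n -> K) : st_pt iota (fin_pt iota x) = x.
Proof. by apply/funext => l; exact: stf_real. Qed.

Lemma phi_evaluation : (forall i, point <> st_pt iota (x_ i)) ->
  forall p, phi p = st iota (finval (poly_of p).@[fin_pt iota point]
                             / finval u.@[fin_pt iota point]).
Proof.
move=> px p; have u0 : stf u.@[fin_pt iota point] != 0.
  by apply: stf_u_neq0 => i; rewrite st_pt_fin.
rewrite st_quotient// -!character_point -character_u mulrC mulKf//.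
by rewrite character_point.
Qed.

Lemma cofactor_in i p : p \isin vanishing_sq (x_ i) -> cofactor_poly i * p \isin I.
Proof.
move=> ip; apply/mem_idealP => j; case: (eqVneq j i) => [->|ji].
  exact: idealMl.
rewrite mulrC; apply: idealMl.
have -> : cofactor_poly i = (\prod_(l < k | (l != i) && (l != j)) sqdist_poly (x_ l))
    * sqdist_poly (x_ j) by rewrite mulrC [LHS](bigD1 j).
by apply: idealMl; exact: sqdist_vanishing_sq.
Qed.

Lemma stf_cofactor_neq0 i : stf (cofactor_poly i).@[x_ i] != 0.
Proof.
rewrite meval_prod rmorph_prod; apply/prodf_neq0 => j ji.
by apply: stf_sqdist_neq0; apply: x_inj; rewrite eq_sym.
Qed.

Definition hessian_denom i : fin R := 2 * (cofactor_poly i).@[x_ i].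

Lemma finval_hessian_denom i : finval (hessian_denom i)
  = 2 * \prod_(j < k | j != i) finval (sqdist_poly (x_ j)).@[x_ i].
Proof.
rewrite /hessian_denom meval_prod /=; congr (_ * _).
by apply: (big_ind2 (fun a b => finval a = b)) => // a _ b _ <- <-.
Qed.

Lemma stf_hessian_denom i :
  stf (hessian_denom i) = 2 * stf (cofactor_poly i).@[x_ i].
Proof. by rewrite rmorphM rmorph_nat. Qed.

Lemma stf_hessian_denom_neq0 i : stf (hessian_denom i) != 0.
Proof.
by rewrite stf_hessian_denom mulf_neq0 ?stf_cofactor_neq0// pnatr_eq0.
Qed.

(** When the point attached to phi is the standard part of x_i, the character kills
    u and no longer determines phi. The product w of the other factors of u is not
    killed, and multiplication by w maps the square of the i-th vanishing ideal into
    the full product; [psi] is the functional p |-> phi (w p) on that larger ideal. *)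
Section SecondOrder.
Context (i : 'I_k) (point_i : point = st_pt iota (x_ i)).

Let psi p : K := phi (to_ideal iota I (cofactor_poly i * p)).

Lemma character_i p : character p = stf p.@[x_ i].
Proof. by apply: character_meval => l; have /(congr1 (@^~ l)) := point_i. Qed.

Lemma psiD p q : p \isin vanishing_sq (x_ i) -> q \isin vanishing_sq (x_ i) ->
  psi (p + q) = psi p + psi q.
Proof.
move=> ip iq; rewrite /psi -phiD; congr (phi _); apply: val_inj => /=.
have iD := cofactor_in (idealD ip iq).
rewrite (poly_of_to_ideal iota iD) (poly_of_to_ideal iota (cofactor_in ip)).
by rewrite (poly_of_to_ideal iota (cofactor_in iq)) mulrDr.
Qed.

Lemma psiM q p : p \isin vanishing_sq (x_ i) ->
  psi (q * p) = stf q.@[x_ i] * psi p.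
Proof.
move=> ip; rewrite /psi -character_i -phi_act; congr (phi _).
apply: val_inj => /=; rewrite (poly_of_to_ideal iota (cofactor_in ip)).
by rewrite (poly_of_to_ideal iota (cofactor_in (idealMl q ip))) mulrCA.
Qed.

Lemma psi_of_ideal v : psi (poly_of v) = stf (cofactor_poly i).@[x_ i] * phi v.
Proof.
rewrite -character_i -phi_act; congr (phi _); apply: val_inj => /=.
by rewrite poly_of_to_ideal//; apply: idealMl; exact: poly_of_in.
Qed.

Lemma psi_sqdist : psi (sqdist_poly (x_ i)) = 1.
Proof.
rewrite -[RHS](state_unit phi_state); congr (phi _); apply: val_inj => /=.
by rewrite poly_of_uI (u_cofactor i) poly_of_to_ideal// -u_cofactor; exact: u_in_ideal.
Qed.

Lemma psi_sqr_ge0 p : p \isin vanishing_ideal (x_ i) -> 0 <= psi (p ^+ 2).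
Proof.
move=> ip; apply: (state_ge0 phi_state) => /=.
rewrite poly_of_to_ideal; last first.
  by apply: cofactor_in; rewrite expr2; exact: ideal_mul_mem.
apply: (qm_sosM M_qm); first by apply: sos_prod => j _; exact: sos_sqdist.
exact/(qm_sos M_qm)/sos_sqr.
Qed.

Lemma psi_sum (F : 'I_n -> poly) : (forall l, F l \isin vanishing_sq (x_ i)) ->
  psi (\sum_l F l) = \sum_l psi (F l).
Proof.
move=> iF; have I0 : 0 \isin vanishing_sq (x_ i) by case: (idealP (vanishing_sq (x_ i))).
suff [] : \sum_l F l \isin vanishing_sq (x_ i) /\ psi (\sum_l F l) = \sum_l psi (F l) by [].
elim/big_rec2: _ => [|l s p _ [ip <-]].
  by split=> //; rewrite -[0 in LHS](mul0r 0) psiM// meval0 rmorph0 mul0r.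
by split; [exact: idealD|rewrite psiD].
Qed.

Local Notation Y := (centered_var (x_ i)).
Let C : 'M[K]_n := \matrix_(l, m) psi (Y l * Y m).

(** [C] is positive semidefinite because [psi] is nonnegative on squares, and has
    trace 1 because the sum of the squares of the [Y] is the i-th factor of u;
    its rank-one summands are the vectors v_l. *)
Lemma phi_second_order : exists v : 'I_n -> 'cV[K]_n,
  \sum_(l < n) ((v l)^T *m v l) 0 0 = 1 /\
  forall p : V, phi p = st iota
    ((\sum_(l < n) ((map_mx iota (v l))^T *m hessian_at (poly_of p) (x_ i)
                    *m map_mx iota (v l)) 0 0)
     / (2 * \prod_(j < k | j != i) finval (sqdist_poly (x_ j)).@[x_ i])).
Proof.
have CE := @quadratic_functional _ _ iota _ psi (x_ i) psiD psiM.
have Csym : C^T = C by apply/matrixP => l m; rewrite !mxE mulrC.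
have Cpsd (w : 'rV_n) : 0 <= (w *m C *m w^T) 0 0.
  pose p := \sum_l poly_real iota n (w 0 l) * Y l.
  have ip : p \isin vanishing_ideal (x_ i).
    rewrite /= (raddf_sum (meval (x_ i))) big1// => l _.
    by rewrite /= mevalM meval_centered_var subrr mulr0.
  have := psi_sqr_ge0 ip; congr (0 <= _).
  have pE : p ^+ 2 = \sum_m \sum_l
      (fin_real iota (w 0 l) * fin_real iota (w 0 m))%:MP * (Y l * Y m).
    rewrite expr2 /p mulr_sumr; apply: eq_bigr => m _.
    rewrite mulr_suml; apply: eq_bigr => l _.
    by rewrite /= mpolyCM; ring.
  have iY l m : Y l * Y m \isin vanishing_sq (x_ i).
    exact: centered_var_mul_sq.
  rewrite pE psi_sum; last first.
    move=> m; apply: (big_ind (fun p => p \isin vanishing_sq (x_ i))).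
    - by case: (idealP (vanishing_sq (x_ i))).
    - by move=> ? ?; exact: idealD.
    - by move=> l _; exact: idealMl.
  rewrite mxE; apply: eq_bigr => m _; rewrite mxE mulr_suml psi_sum; last first.
    by move=> l; exact: idealMl.
  apply: eq_bigr => l _; rewrite psiM// mevalC rmorphM /= !stf_real.
  by rewrite !mxE; ring.
have [v vE] := psd_sum_rank_one Csym Cpsd.
have trC : \tr C = 1.
  have := CE _ (@sqdist_vanishing_sq _ _ (x_ i)).
  rewrite psi_sqdist -[sqdist_poly _]mul1r hessian_form_sqdist.
  rewrite meval1 rmorph1 mul1r; lra.
exists (fun l => (v l)^T); split.
  rewrite -trC vE [RHS]raddf_sum; apply: eq_bigr => l _.
  by rewrite /= trmxK mxtrace_mulC trace_mx11.
move=> p; rewrite -finval_hessian_denom st_hessian_quotient ?stf_hessian_denom_neq0//.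
have -> : \sum_l (v l)^T *m ((v l)^T)^T = C.
  by rewrite vE; apply: eq_bigr => l _; rewrite trmxK.
rewrite -CE ?psi_of_ideal ?stf_hessian_denom; last first.
  by move/mem_idealP: (poly_of_in p); exact.
have := stf_cofactor_neq0 i; set d := stf _ => d0; field.
exact: d0.
Qed.

End SecondOrder.
End OnePureState.

(** Each of the two formulas determines the character of phi, hence the point; this
    is what makes the two cases exclusive. *)
Lemma phi_act_evaluation (phi : V -> K^o) (x : 'I_n -> K) :
  (forall i, x <> st_pt iota (x_ i)) ->
  (forall p : V, phi p = st iota (finval (poly_of p).@[fin_pt iota x]
                             / finval u.@[fin_pt iota x])) ->
  forall q, phi (act q uI) = stf q.@[fin_pt iota x].
Proof.
move=> xx phiE q; have u0 : stf u.@[fin_pt iota x] != 0.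
  by apply: stf_u_neq0 => i; rewrite st_pt_fin.
by rewrite phiE st_quotient//= poly_of_uI mevalM rmorphM mulfK.
Qed.

Lemma phi_act_second_order (phi : V -> K^o) i (v : 'I_n -> 'cV[K]_n) :
  \sum_(l < n) ((v l)^T *m v l) 0 0 = 1 ->
  (forall p : V, phi p = st iota
    ((\sum_(l < n) ((map_mx iota (v l))^T *m hessian_at (poly_of p) (x_ i)
                    *m map_mx iota (v l)) 0 0)
     / (2 * \prod_(j < k | j != i) finval (sqdist_poly (x_ j)).@[x_ i]))) ->
  forall q, phi (act q uI) = stf q.@[x_ i].
Proof.
move=> v1 phiE q.
rewrite phiE -finval_hessian_denom st_hessian_quotient ?stf_hessian_denom_neq0//.
have -> : poly_of (act q uI) = (q * cofactor_poly i) * sqdist_poly (x_ i).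
  by rewrite /= poly_of_uI (u_cofactor i) mulrA.
rewrite hessian_form_sqdist mevalM rmorphM stf_hessian_denom.
have -> : \tr (\sum_l v l *m (v l)^T) = 1.
  rewrite -v1 raddf_sum; apply: eq_bigr => l _.
  by rewrite /= mxtrace_mulC trace_mx11.
have := stf_cofactor_neq0 i; set d := stf (cofactor_poly i).@[_] => d0; field.
exact: d0.
Qed.

End PureStatesOnIdeals.

Theorem theorem26 (K : realType) (R : rcfType) (iota : {rmorphism K -> R})
    (n : nat) (M : set {mpoly (fin R)[n]})
    (M_qm : quadratic_module M) (M_arch : archimedean_qm M)
    (k : nat) (x_ : 'I_k -> 'I_n -> fin R)
    (x_inj : forall i j : 'I_k, i != j ->
       st_pt iota (x_ i) <> st_pt iota (x_ j)) :
  let S : set ('I_n -> K) :=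
    [set x | forall p, M p -> 0 <= st iota (finval p.@[fin_pt iota x])] in
  let I2 (i : 'I_k) : ideal {mpoly (fin R)[n]} :=
    ideal_mul (vanishing_ideal (x_ i)) (vanishing_ideal (x_ i)) in
  let I : ideal {mpoly (fin R)[n]} :=
    \big[@ideal_mul {mpoly (fin R)[n]} / idealT {mpoly (fin R)[n]}]_(i < k)
      I2 i in
  let MI : set (ideal_space I iota) := [set p | M (poly_of p)] in
  let u : {mpoly (fin R)[n]} := \prod_(i < k) sqdist_poly (x_ i) in
  (I : set {mpoly (fin R)[n]}) =
    \bigcap_(i in [set: 'I_k]) (I2 i : set {mpoly (fin R)[n]}) /\
  exists uI : ideal_space I iota,
    [/\ poly_of uI = u,
        unit_for MI uI
      & forall phi : ideal_space I iota -> K^o, pure_states MI uI phi ->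
          let case1 :=
            exists x : 'I_n -> K,
              [/\ S x,
                  forall i : 'I_k, x <> st_pt iota (x_ i)
                & forall p : ideal_space I iota,
                    phi p = st iota (finval (poly_of p).@[fin_pt iota x]
                                     / finval u.@[fin_pt iota x])] in
          let case2 :=
            exists (i : 'I_k) (v : 'I_n -> 'cV[K]_n),
              \sum_(l < n) ((v l)^T *m v l) 0 0 = 1 /\
              forall p : ideal_space I iota,
                phi p = st iota
                  ((\sum_(l < n) ((map_mx iota (v l))^T
                                  *m hessian_at (poly_of p) (x_ i)
                                  *m map_mx iota (v l)) 0 0)
                   / (2 * \prod_(j < k | j != i)
                            finval (sqdist_poly (x_ j)).@[x_ i])) in
          (case1 \/ case2) /\ ~ (case1 /\ case2)].
Proof.
move=> S I2 I MI u; split; first exact: (ideal_bigcapE x_inj).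
exists (uI iota x_); split; first exact: poly_of_uI.
  exact: u_unit.
move=> phi phi_pure case1 case2; split.
  have [[i px]|px] := pselect (exists i, point phi = st_pt iota (x_ i)).
    by right; exists i; exact: (phi_second_order M_qm M_arch x_inj phi_pure px).
  have pnx i : point phi <> st_pt iota (x_ i) by move=> pi; apply: px; exists i.
  left; exists (point phi); split=> //.
    by move=> p; exact: (point_nonneg M_qm M_arch x_inj phi_pure).
  exact: (phi_evaluation M_qm M_arch x_inj phi_pure).
move=> [[x [_ xx phiE1]] [i [v [v1 phiE2]]]]; apply: (xx i).
apply/funext => l.
have := phi_act_evaluation x_inj xx phiE1 'X_l.
by rewrite (phi_act_second_order x_inj v1 phiE2) !mevalXU stf_real.
Qed.
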